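(* Let $G$ be a 2-edge-connected graph and $k$ a positive integer. Then $G$ can be made 4-edge-connected by doubling at most $k$ edges if and only if $G$ has a 2-arc-strong partial orientation in which at most $k$ edges remain unoriented.
   Context: Graphs and mixed graphs may have parallel edges and arcs but no loops. Doubling an edge means adding one parallel copy of it (each edge of $G$ may be doubled at most once, i.e. one chooses a set of edges and adds one copy of each). A mixed graph $M=(V,E,A)$ has edge set $E$ and arc set $A$. A partial orientation of an undirected graph is a mixed graph obtained by orienting some (possibly none or all) of its edges. For a positive integer $\ell$, a mixed graph $M=(V,E,A)$ is $\ell$-arc-strong if for every non-empty proper subset $X$ of $V$, the number of arcs of $A$ leaving $X$ plus the number of edges of $E$ with exactly one end in $X$ is at least $\ell$. *)

(* Defs.v *)
From mathcomp Require Import all_boot.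
Set Implicit Arguments.
Unset Strict Implicit.
Unset Printing Implicit Defensive.

(* Edges are the elements of a finite type, so that parallel edges are
   distinct edges with the same ends; two ends means no loops. *)
Record graph (V : finType) := Graph {
  edge : finType;
  ends : edge -> {set V};
  card_ends : forall e, #|ends e| = 2
}.

Record mixed_graph (V : finType) := MixedGraph {
  medge : finType;
  mends : medge -> {set V};
  card_mends : forall e, #|mends e| = 2;
  arc : finType;
  tail : arc -> V;
  head : arc -> V;
  tail_neq_head : forall a, tail a != head a
}.

Arguments card_ends {V} g e.
Arguments card_mends {V} m e.
Arguments tail_neq_head {V} m a.

Definition edge_cut (V : finType) (G : graph V) (X : {set V}) : {set edge G} :=
  [set e | #|ends e :&: X| == 1].

Definition medge_cut (V : finType) (M : mixed_graph V) (X : {set V}) :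
    {set medge M} :=
  [set e | #|mends e :&: X| == 1].

Definition arcs_leaving (V : finType) (M : mixed_graph V) (X : {set V}) :
    {set arc M} :=
  [set a | (tail a \in X) && (head a \notin X)].

(* This is arc_strong for a mixed graph without arcs; a graph with one vertex
   satisfies it for every l. *)
Definition edge_connected (l : nat) (V : finType) (G : graph V) : Prop :=
  forall X : {set V}, X != set0 -> X \proper [set: V] -> l <= #|edge_cut G X|.

Definition arc_strong (l : nat) (V : finType) (M : mixed_graph V) : Prop :=
  forall X : {set V}, X != set0 -> X \proper [set: V] ->
    l <= #|arcs_leaving M X| + #|medge_cut M X|.

(* The right summand consists of the added parallel copies of the edges in D. *)
Definition double_ends (V : finType) (G : graph V) (D : {set edge G})
    (e : edge G + {e : edge G | e \in D}) : {set V} :=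
  match e with inl e => ends e | inr e' => ends (val e') end.

Lemma card_double_ends (V : finType) (G : graph V) (D : {set edge G}) e :
  #|@double_ends V G D e| = 2.
Proof. by case: e => e; apply: card_ends. Qed.

Definition double_graph (V : finType) (G : graph V) (D : {set edge G}) : graph V :=
  Graph (@card_double_ends V G D).

(* f sends each edge or arc of M to the edge of G it comes from. *)
Definition partial_orientation (V : finType) (G : graph V)
    (M : mixed_graph V) : Prop :=
  exists f : medge M + arc M -> edge G,
    [/\ bijective f,
        forall e : medge M, ends (f (inl e)) = mends e
      & forall a : arc M, ends (f (inr a)) = [set tail a; head a]].

(* Main.v *)
Require Import Defs.
From mathcomp Require Import all_boot.
From mathcomp Require Import zify.

(** If the unoriented edges of M form D, adding the conditions on X and on its
    complement shows that every cut of G with D doubled has at least 4 edges.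
    Conversely, give every edge outside D half an arc in each direction, and
    every edge of D a full arc in each direction.  Then every set X has twice
    its out-weight equal to its degree in the doubled graph, hence at least 4,
    and it remains to round the halves.  Twice the out-weight minus 4 is a
    crossing submodular function b, and the undecided edges have even degree at
    every tight set (b X = 0).  Parity yields a cyclic sequence of oriented
    undecided edges such that every tight set containing the head of one
    contains the tail of the next; orienting the edges of a chordless such
    cycle keeps b nonnegative, and one concludes by induction on the number of
    undecided edges. *)

Set Implicit Arguments.
Unset Strict Implicit.
Unset Printing Implicit Defensive.

Lemma sub_in_count (T : eqType) (a1 a2 : pred T) (s : seq T) :
  {in s, forall x, a1 x -> a2 x} -> count a1 s <= count a2 s.
Proof.
move=> a12; have -> : count a1 s = count [predI a1 & [in s]] s.
  by apply: eq_in_count => x xs; rewrite /= xs andbT.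
by apply: sub_count => x /andP[? /a12]; apply.
Qed.

(** * Tight sets of a crossing submodular function *)

Section CrossingSubmodular.

Variables (V : finType) (b : {set V} -> nat).

Definition nontrivial (X : {set V}) := (X != set0) && (X != [set: V]).

Definition crossing_submodular :=
  forall X Y : {set V}, X :&: Y != set0 -> X :|: Y != [set: V] ->
    b (X :&: Y) + b (X :|: Y) <= b X + b Y.

Hypothesis b_submod : crossing_submodular.

Lemma crossing_nontrivial (X Y : {set V}) :
    X :&: Y != set0 -> X :|: Y != [set: V] ->
  [/\ nontrivial X, nontrivial Y, nontrivial (X :&: Y) & nontrivial (X :|: Y)].
Proof.
move=> XY0 XYT; rewrite /nontrivial XY0 XYT setU_eq0.
have [X0 Y0] : X != set0 /\ Y != set0.
  by split; apply: contraNneq XY0 => ->; rewrite ?setI0 ?set0I.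
have [XT YT] : X != setT /\ Y != setT.
  by split; apply: contraNneq XYT => ->; rewrite ?setUT ?setTU.
rewrite X0 Y0 XT YT (negPf X0); split=> //.
by apply: contraNneq XT => IT; rewrite -subTset -IT subsetIl.
Qed.

Definition tight X := nontrivial X && (b X == 0).

(** The union of this family is the union of all tight sets avoiding [u]. *)
Definition tight_avoiding u : {set {set V}} :=
  [set C | maxset (fun X => tight X && (u \notin X)) C].

Lemma tight_avoidingP u C :
  C \in tight_avoiding u -> [/\ C != set0, b C = 0 & u \notin C].
Proof. by rewrite inE => /maxsetp/andP[/andP[/andP[-> _] /eqP->] ->]. Qed.

Lemma notin_setT (u : V) (X : {set V}) : u \notin X -> X != [set: V].
Proof. by apply: contraNneq => ->; rewrite inE. Qed.

Lemma set_neq0 (u : V) (X : {set V}) : u \in X -> X != set0.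
Proof. by move=> uX; apply/set0Pn; exists u. Qed.

Lemma sub_tight_avoiding u X : tight X -> u \notin X ->
  exists2 C, C \in tight_avoiding u & X \subset C.
Proof.
move=> tX uX.
have [|C maxC sXC] := @maxset_exists _ (fun X => tight X && (u \notin X)) X.
  by rewrite tX.
by exists C; rewrite ?inE.
Qed.

(** Submodularity makes the union of two intersecting members tight; it still avoids [u], so
    maximality identifies both members with it. *)
Lemma tight_avoiding_disjoint u C D :
    C \in tight_avoiding u -> D \in tight_avoiding u -> C :&: D != set0 ->
  C = D.
Proof.
move=> Cu Du CD0; have [C0 bC uC] := tight_avoidingP Cu.
have [D0 bD uD] := tight_avoidingP Du.
have uCD : u \notin C :|: D by rewrite inE (negPf uC).
have tCD : tight (C :|: D) && (u \notin C :|: D).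
  rewrite uCD andbT /tight /nontrivial (notin_setT uCD) setU_eq0 (negPf C0) /=.
  have := b_submod CD0 (notin_setT uCD); lia.
move: Cu Du; rewrite !inE => maxC maxD.
rewrite -(maxsetsup maxC tCD (subsetUl _ _)).
by rewrite -{2}(maxsetsup maxD tCD (subsetUr _ _)).
Qed.

Lemma trivIset_tight_avoiding u : trivIset (tight_avoiding u).
Proof.
apply/trivIsetP=> C D Cu Du; apply: contraR; rewrite -setI_eq0 => CD0.
by rewrite (tight_avoiding_disjoint Cu Du).
Qed.

Lemma notin_cover_tight_avoiding u : u \notin cover (tight_avoiding u).
Proof.
by apply/negP=> /bigcupP[C /tight_avoidingP[_ _ /negP uC]].
Qed.

(* Enlarging B' by a tight set C decreases b B' by at least b (B :&: C), hence
   by at least T - S at B :&: C: the deficit passes to the rest of B. *)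
Lemma uncross_family (S T : {set V} -> nat) (B : {set V}) u (cs : seq {set V}) :
    (forall X Y : {set V}, [disjoint X & Y] -> S (X :|: Y) = S X + S Y) ->
    (forall X Y : {set V}, [disjoint X & Y] -> T (X :|: Y) = T X + T Y) ->
    u \notin B -> b B + S B < T B ->
    (forall C, C \in cs -> C :&: B != set0 ->
       T (B :&: C) <= b (B :&: C) + S (B :&: C)) ->
    uniq cs -> {subset cs <= tight_avoiding u} ->
  exists B' : {set V},
    [/\ B \subset B', B' \subset B :|: \bigcup_(C <- cs) C, u \notin B' &
     b B' + S (B :\: \bigcup_(C <- cs) C) < T (B :\: \bigcup_(C <- cs) C)].
Proof.
move=> S_add T_add uB violB; elim: cs => [|C cs IHcs] B_ok.
  by exists B; rewrite big_nil setU0 setD0.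
rewrite /= => /andP[C'cs Ucs] cs_tight.
have [D Dcs|D Dcs|B' [sBB' sB'BK uB' violB']] := IHcs _ Ucs.
- by apply: B_ok; rewrite inE Dcs orbT.
- by apply: cs_tight; rewrite inE Dcs orbT.
rewrite big_cons; set K := \bigcup_(C <- cs) C in sB'BK violB' *.
have Cu : C \in tight_avoiding u by rewrite cs_tight ?mem_head.
have [C0 bC uC] := tight_avoidingP Cu.
have dCK : [disjoint C & K].
  rewrite /K; elim: (cs) C'cs cs_tight => [|D ds IHds].
    by rewrite big_nil -setI_eq0 setI0.
  rewrite inE negb_or => /andP[CD C'ds] cs_t.
  rewrite big_cons -setI_eq0 setIUr setU_eq0; apply/andP; split.
    apply: contraR CD => CD0; apply/eqP.
    apply: (tight_avoiding_disjoint Cu _ CD0).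
    by apply: cs_t; rewrite !inE eqxx orbT.
  rewrite setI_eq0; apply: IHds C'ds _ => E; rewrite inE => /orP[/eqP->|Eds] //.
  by apply: cs_t; rewrite !inE Eds !orbT.
(* A member that misses [B] is skipped: it removes nothing from [B :\: K]. *)
have [CB0|CB0] := eqVneq (C :&: B) set0.
  exists B'; split=> //.
    by apply: subset_trans sB'BK _; rewrite setUCA subsetUr.
  suff -> : B :\: (C :|: K) = B :\: K by [].
  apply/setP=> x; rewrite !inE; move/setP/(_ x): CB0; rewrite !inE.
  by do 3!case: (x \in _).
(* [B'] extends [B] only by points of [K], which is disjoint from [C]. *)
have B'C : B' :&: C = B :&: C.
  apply/setP=> x; rewrite !inE; have := subsetP sBB' x.
  have := subsetP sB'BK x; rewrite !inE.
  have := disjointFr dCK (x := x).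
  case: (x \in C) => [->|]; rewrite ?andbF // orbF !andbT => // xB' xB.
  by apply/idP/idP.
exists (B' :|: C); split.
- by apply: subset_trans sBB' (subsetUl _ _).
- by rewrite setUCA setUC setUS.
- by rewrite inE negb_or uB'.
have uB'C : u \notin B' :|: C by rewrite inE negb_or uB'.
have := B_ok _ (mem_head C cs) CB0.
have BC0 : B' :&: C != set0 by rewrite B'C setIC.
have := b_submod BC0 (notin_setT uB'C); rewrite B'C bC.
have BK : B :\: K = (B :&: C) :|: (B :\: (C :|: K)).
  apply/setP=> x; rewrite !inE; have := disjointFr dCK (x := x).
  case: (x \in C) => [->|] //=; last by rewrite andbF.
  by rewrite andbT orbF.
have dBC : [disjoint B :&: C & B :\: (C :|: K)].
  rewrite -setI_eq0; apply/eqP/setP=> x; rewrite !inE.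
  by case: (x \in C); rewrite ?andbF.
by move: violB'; rewrite BK S_add // T_add //; lia.
Qed.

End CrossingSubmodular.

(** * Oriented elements and the parity of cuts *)

Section Rounding.

Variables (V I : finType) (p q : I -> V).

Definition src (d : I * bool) := if d.2 then p d.1 else q d.1.
Definition dst (d : I * bool) := if d.2 then q d.1 else p d.1.

Definition separated i (X : {set V}) := (p i \in X) (+) (q i \in X).

Definition cut_parity (U : {set I}) X := \big[addb/false]_(i in U) separated i X.

Lemma separatedE d X :
  separated d.1 X = (src d \in X) (+) (dst d \in X).
Proof. by rewrite /separated /src /dst; case: d.2 => //=; rewrite addbC. Qed.

Lemma odd_sum (J : Type) (r : seq J) P (F : J -> nat) :
  odd (\sum_(j <- r | P j) F j) = \big[addb/false]_(j <- r | P j) odd (F j).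
Proof. exact: (big_morph odd oddD). Qed.

(** Modulo 2, the cut of [X] is the sum of the [U]-degrees of the vertices in [X], since an element
    with both ends in [X] counts twice; such sums are additive over disjoint sets. *)
Lemma cut_parity_cover (U : {set I}) (P : {set {set V}}) : trivIset P ->
  cut_parity U (cover P) = \big[addb/false]_(A in P) cut_parity U A.
Proof.
move=> tP; have cutE X : cut_parity U X =
    \big[addb/false]_(x in X) \big[addb/false]_(i in U) ((p i == x) (+) (q i == x)).
  have memE y : (y \in X) = \big[addb/false]_(x in X) (y == x).
    have [yX|yX] := boolP (y \in X).
      rewrite (bigD1 y) //= eqxx big1 // => x /andP[_].
      by rewrite eq_sym => /negPf.
    by rewrite big1 // => x xX; apply: contraNF yX => /eqP->.
  rewrite exchange_big; apply: eq_bigr => i _ /=.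
  by rewrite /separated big_split /= -!memE.
by rewrite cutE big_trivIset //; apply: eq_bigr => A _; rewrite cutE.
Qed.

(** * Exchange cycles *)

Section Exchange.

Variable b : {set V} -> nat.

(** Orienting along [d] will lower [b X] by 1 when [dst d] is in [X] and raise it by 1 when [src d]
    is. A tight set has nothing to lose, so whatever [d] takes from it, [d'] must give back. *)
Definition reaches : rel (I * bool) := fun d d' =>
  [forall X : {set V}, tight b X ==> (dst d \in X) ==> (src d' \in X)].

Lemma reachesP d d' :
  reflect (forall X, tight b X -> dst d \in X -> src d' \in X) (reaches d d').
Proof.
apply: (iffP forallP) => [dd X tX dX|dd X].
  by have := dd X; rewrite tX dX.
by apply/implyP=> tX; apply/implyP; apply: dd.
Qed.

Hypothesis b_submod : crossing_submodular b.

(** The union [K] of the tight sets avoiding [src d] has an even cut, which contains [d.1] and hence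
    some other element. Orient that one with its head outside [K]: a tight set containing this head
    does not lie in [K], so it contains [src d]. *)
Lemma reaches_pred (U : {set I}) (d : I * bool) :
    (forall X, nontrivial X -> odd (b X) = cut_parity U X) ->
    d.1 \in U -> ~~ reaches d d ->
  exists d', [/\ d'.1 \in U, d'.1 != d.1 & reaches d' d].
Proof.
move=> oddb dU; set K := cover (tight_avoiding b (src d)) => NRdd.
have [uK vK] : src d \notin K /\ dst d \in K.
  split; first exact: notin_cover_tight_avoiding.
  have: [exists X : {set V}, [&& tight b X, dst d \in X & src d \notin X]].
    apply: contraR NRdd; rewrite negb_exists => /forallP noX.
    apply/reachesP=> X tX dX; have := noX X.
    by rewrite tX dX negbK.
  case/existsP=> X /and3P[tX dX sX].
  have [C Cu sXC] := sub_tight_avoiding tX sX.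
  by apply/bigcupP; exists C => //; apply: (subsetP sXC).
have evenK : cut_parity U K = false.
  rewrite cut_parity_cover ?trivIset_tight_avoiding // big1 // => C Cu.
  have [C0 bC uC] := tight_avoidingP Cu.
  by rewrite -oddb ?bC // /nontrivial C0 (notin_setT uC).
have [i /and3P[iU id sepi]|noi] :=
    pickP (fun i => [&& i \in U, i != d.1 & separated i K]); last first.
  move: evenK; rewrite /cut_parity (bigD1 d.1) //= separatedE (negPf uK) vK big1 //.
  by move=> i /andP[iU id]; have := noi i; rewrite iU id.
suff [d' Dd' vd'] : exists2 d', d'.1 = i & dst d' \notin K.
  exists d'; rewrite Dd' iU id; split=> //; apply/reachesP=> X tX; apply: contraTT.
  move=> uX; apply: contra vd' => vX; have [C Cu sXC] := sub_tight_avoiding tX uX.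
  by apply/bigcupP; exists C => //; apply: (subsetP sXC).
have [qK|qK] := boolP (q i \in K); last by exists (i, true).
by exists (i, false) => //; move: sepi; rewrite /separated /dst /= qK; case: (_ \in K).
Qed.

(** Distinctness concerns the underlying elements, so that none occurs in both orientations. *)
Definition edge_cycle (c : seq (I * bool)) :=
  [&& c != [::], cycle reaches c & uniq (map fst c)].

(** A walk is extended backwards by [reaches_pred] until its first entry reaches itself or an
    element repeats; either event closes a cycle. *)
Lemma edge_cycle_exists (U : {set I}) (d : I * bool) :
    (forall X, nontrivial X -> odd (b X) = cut_parity U X) ->
    d.1 \in U ->
  exists2 c : seq (I * bool), edge_cycle c & {subset [seq e.1 | e <- c] <= U}.
Proof.
move=> oddb dU.
pose good (c : seq (I * bool)) := edge_cycle c && all [in U] (map fst c).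
suff [c /andP[cc /allP cU]] : exists c, good c by exists c.
have walk n : (exists c, good c) \/ exists e c,
    [/\ path reaches e c, uniq (map fst (e :: c)),
        all [in U] (map fst (e :: c)) & size c = n].
  elim: n => [|n [|[e [c [ec Uc cU sc]]]]]; [right|by left|].
    by exists d, [::]; rewrite /= dU.
  have eU : e.1 \in U by case/andP: cU.
  have [Ree|NRee] := boolP (reaches e e).
    by left; exists [:: e]; rewrite /good /edge_cycle /= Ree eU.
  have [d' [d'U d'e Rd'e]] := reaches_pred oddb eU NRee.
  have [d'c|d'c] := boolP (d'.1 \in map fst c); last first.
    right; exists d', (e :: c); split; rewrite ?[path _ _ _]/= ?Rd'e //=.
    - by rewrite inE negb_or d'e d'c; exact: Uc.
    - by rewrite d'U.
    - by rewrite sc.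
  left; case/mapP: d'c => f fc Dd'.
  case/splitPr: fc ec Uc cU => c1 c2; rewrite cat_path => /and3P[ec1 lf _].
  rewrite -cat_rcons -cat_cons map_cat cat_uniq all_cat => /andP[Uc _] /andP[cU _].
  rewrite map_cons map_rcons in Uc cU.
  have {}cU : all [in U] (map fst (f :: e :: c1)).
    by move: cU; rewrite /= all_rcons => /and3P[-> ->].
  have {}Uc : uniq (map fst (f :: e :: c1)).
    by move: Uc; rewrite -rcons_cons rcons_uniq.
  have [d'f|d'f] := eqVneq d' f.
    exists (f :: e :: c1); rewrite /good cU andbT; apply/and3P; split=> //.
    by rewrite -d'f [cycle _ _]/= Rd'e rcons_path ec1 d'f.
  (* Here d' is the reversal of f, hence [dst d' = src f] and the walk closes
     up without using the edge of f. *)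
  exists (e :: c1); apply/andP; split; last by case/andP: cU.
  apply/and3P; split=> //; last by case/andP: Uc.
  rewrite [cycle _ _]/= rcons_path ec1 /=.
  suff dd' : dst d' = src f.
    apply/reachesP=> X tX /(reachesP _ _ lf _ tX); rewrite -dd'.
    exact: (reachesP _ _ Rd'e).
  by move: Dd' d'f; case: (d') (f) => [i []] [j []] /= -> //; rewrite eqxx.
(* Such a walk [e :: c] would have [#|I| + 1] distinct elements. *)
have [//|[e [c [_ Uc _ sc]]]] := walk #|I|.
by have := max_card [in map fst (e :: c)]; rewrite (card_uniqP Uc) /= size_map sc ltnn.
Qed.

(** A chord from [d] to [d'] closes the stretch from [d'] to [d] into a shorter cycle. *)
Lemma chordless_edge_cycle (c : seq (I * bool)) : edge_cycle c ->
  exists c', [/\ edge_cycle c', {subset c' <= c}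
    & {in c' &, forall d d', reaches d d' -> d' = next c' d}].
Proof.
have [n] := ubnP (size c); elim: n c => // n IHn c ltcn cc.
have [/allP noc|] :=
    boolP (all (fun d => all (fun d' => reaches d d' ==> (d' == next c d)) c) c).
  exists c; split=> // d d' dc d'c Rdd'; apply/eqP.
  by have /allP/(_ _ d'c) := noc d dc; rewrite Rdd'.
case/allPn=> d dc /allPn[d' d'c]; rewrite negb_imply => /andP[Rdd' d'next].
have /and3P[_ Rc Uc] := cc; have Uc' := map_uniq Uc.
have [i c1 Dc] := rot_to d'c.
have memc x : (x \in c) = (x \in d' :: c1) by rewrite -Dc mem_rot.
move: dc ltcn d'next Rc Uc; rewrite memc -(size_rot i) -(next_rot i) //.
rewrite -(rot_cycle i) -(rot_uniq i) -map_rot Dc => dc.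
case/splitPl: dc {Dc} memc => c2 c3 lastd memc ltcn d'next Rc Uc.
have [||c' [cc' sc' ch]] := IHn (d' :: c2).
- case: c3 memc ltcn d'next Rc Uc => [|e c3] _; last first.
    by rewrite /= size_cat /= => ltcn *; lia.
  rewrite cats0 => _ d'next _ /map_uniq Uc2; case/eqP: d'next.
  (* If nothing follows [d], then [next] falls back on the default [d'] of [nth], so the chord is an
     ordinary step of the cycle. *)
  by rewrite next_nth -lastd mem_last index_last // nth_default.
- apply/and3P; split=> //.
    rewrite [cycle _ _]/= rcons_path lastd Rdd' andbT.
    by move: Rc; rewrite /= rcons_cat cat_path => /andP[].
  exact: subseq_uniq (map_subseq _ (prefix_subseq (d' :: c2) c3)) Uc.
exists c'; split=> // x /sc'; rewrite memc.
exact: (mem_subseq (prefix_subseq (d' :: c2) c3)).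
Qed.

(* A minimal violated set B contains some dst d but not u := src (next c d).
   By chordlessness the tight sets avoiding u cover the other heads dst e, so
   uncrossing B with the maximal ones leaves a deficit of at most 1, and yields
   a tight set containing dst d but not u. *)
Lemma chordless_cycle_feasible (c : seq (I * bool)) : edge_cycle c ->
    {in c &, forall d d', reaches d d' -> d' = next c d} ->
    forall X : {set V}, nontrivial X ->
  count (fun d => dst d \in X) c <= b X + count (fun d => src d \in X) c.
Proof.
move=> /and3P[_ Rc /map_uniq Uc] chordless.
(* Counting tails through [next] pairs each head with the tail it reaches; the total is unchanged
   because [next c] permutes [c]. *)
pose S (X : {set V}) := count (fun d : I * bool => src (next c d) \in X) c.
pose T (X : {set V}) := count (fun d : I * bool => dst d \in X) c.
have SE (X : {set V}) : count (fun d => src d \in X) c = S X.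
  have /permP/(_ (fun d => src d \in X)) : perm_eq c (map (next c) c).
    apply: uniq_perm => //.
      by rewrite map_inj_in_uniq // => x y _ _; apply: (can_inj (prev_next Uc)).
    move=> x; apply/idP/mapP=> [xc|[y yc ->]]; last by rewrite mem_next.
    by exists (prev c x); rewrite ?mem_prev ?next_prev.
  by rewrite count_map.
have count_add (f : I * bool -> V) (X Y : {set V}) : [disjoint X & Y] ->
    count (fun d => f d \in X :|: Y) c =
    count (fun d => f d \in X) c + count (fun d => f d \in Y) c.
  move=> dXY; rewrite -count_predUI [X in _ + X](_ : _ = 0) ?addn0.
    by apply: eq_count => d; rewrite /= inE.
  rewrite -(count_pred0 c); apply: eq_count => d /=.
  by case: (boolP (f d \in X)) => //= /(disjointFr dXY).
pose bad (X : {set V}) := nontrivial X && (b X + S X < T X).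
move=> X ntX; rewrite SE leqNgt; apply/negP => badX.
have {X ntX badX} [B /minsetP[/andP[ntB badB] minB] _] :
    {B | minset bad B & B \subset X}.
  by apply: minset_exists; rewrite /bad ntX.
(* Otherwise [T B <= S B] by comparing term by term, and [B] is not violated. *)
have /hasP[d dc /andP[dB nB]] :
    has (fun d => (dst d \in B) && (src (next c d) \notin B)) c.
  apply: contraLR badB => /hasPn ndB; rewrite -leqNgt.
  apply: leq_trans (leq_addl _ _).
  by apply: sub_in_count => d /ndB; case: (dst d \in B) => //= /negbNE.
set u := src (next c d) in nB.
have Rd e : e \in c -> reaches e (next c e) by apply: next_cycle.
have dC C : C \in tight_avoiding b u -> dst d \notin C.
  move=> Cu; have [_ _ uC] := tight_avoidingP Cu; apply: contra uC.
  move: Cu; rewrite inE => /maxsetp/andP[tC _].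
  exact: (reachesP _ _ (Rd d dc)).
have coverE : \bigcup_(C <- enum (tight_avoiding b u)) C = cover (tight_avoiding b u).
  by rewrite big_enum.
have [||||C|||B' [sBB' _ uB']] :=
  @uncross_family _ b b_submod S T B u (enum (tight_avoiding b u)) => //.
- exact: (count_add (fun d => src (next c d))).
- exact: (count_add dst).
- rewrite mem_enum => Cu CB0; rewrite leqNgt; apply/negP => badBC.
  have [C0 _ uC] := tight_avoidingP Cu.
  (* A violated [B :&: C] equals [B] by minimality, yet it lacks [dst d]. *)
  have : B :&: C = B.
    apply: minB; last exact: subsetIl.
    rewrite /bad badBC andbT /nontrivial setIC CB0 (@notin_setT _ u) //.
    by rewrite inE (negPf uC).
  by move/setP/(_ (dst d)); rewrite inE dB (negPf (dC C Cu)).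
- exact: enum_uniq.
- by move=> C; rewrite mem_enum.
rewrite coverE => viol.
(* Only [d] reaches [next c d], so every other head lies in some tight set avoiding [u]. *)
have T1 : T (B :\: cover (tight_avoiding b u)) <= 1.
  apply: leq_trans (_ : count (pred1 d) c <= 1); last first.
    by rewrite count_uniq_mem // leq_b1.
  apply: sub_in_count => e ec; rewrite inE /=; have [//|ed] := eqVneq e d.
  suff -> : dst e \in cover (tight_avoiding b u) by [].
  have: ~~ reaches e (next c d).
    apply: contra ed => /chordless -/(_ ec); rewrite mem_next => /(_ dc).
    by move/(can_inj (prev_next Uc)) => ->.
  rewrite negb_forall => /existsP[X]; rewrite !negb_imply => /and3P[tX eX uX].
  have [C Cu sXC] := sub_tight_avoiding tX uX.
  by apply/bigcupP; exists C => //; apply: (subsetP sXC).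
(* A deficit of at most 1 forces [b B' = 0]. *)
have tB' : tight b B'.
  rewrite /tight /nontrivial (notin_setT uB') (@set_neq0 _ (dst d)) ?(subsetP sBB') //=.
  by move: viol T1; lia.
by move: uB'; rewrite (reachesP _ _ (Rd d dc)) // (subsetP sBB').
Qed.

End Exchange.

(** Replacing two opposite half arcs by one full arc changes twice the out-weight of [X] by plus 1
    for a tail in [X] and minus 1 for a head in [X]. The conclusion says that the total loss never
    exceeds the slack [b X]. *)
Lemma half_integral_rounding (U : {set I}) (b : {set V} -> nat) :
    crossing_submodular b ->
    (forall X, nontrivial X -> odd (b X) = cut_parity U X) ->
  exists s : I -> bool, forall X : {set V}, nontrivial X ->
    \sum_(i in U) (dst (i, s i) \in X) <= b X + \sum_(i in U) (src (i, s i) \in X).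
Proof.
have [n] := ubnP #|U|; elim: n U b => // n IHn U b ltUn b_submod oddb.
have [->|/set0Pn[i iU]] := eqVneq U set0.
  by exists xpredT => X _; rewrite !big_set0.
have [c0 cc0 c0U] := @edge_cycle_exists b b_submod U (i, true) oddb iU.
have [c [cc sc chordless]] := chordless_edge_cycle cc0.
have feas := chordless_cycle_feasible b_submod cc chordless.
have /and3P[c_neq0 _ Uc] := cc.
have cU : {subset [seq d.1 | d <- c] <= U}.
  by move=> j /mapP[d /sc dc ->]; apply: c0U; apply: map_f.
pose S (X : {set V}) := count (fun d : I * bool => src d \in X) c.
pose T (X : {set V}) := count (fun d : I * bool => dst d \in X) c.
pose U' := U :\: [set j in map fst c].
have bigU (R : Type) (idx : R) (op : Monoid.com_law idx) F :
    \big[op/idx]_(j in U) F j =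
    op (\big[op/idx]_(d <- c) F d.1) (\big[op/idx]_(j in U') F j).
  rewrite (big_setID [set j in map fst c]) /=; congr (op _ _).
  rewrite -(big_map fst predT F) big_uniq //=; apply: eq_bigl => j.
  by rewrite !inE; apply: andb_idl; apply: cU.
have count_mod (f : I * bool -> V) (X Y : {set V}) :
    count (fun d => f d \in X :&: Y) c + count (fun d => f d \in X :|: Y) c =
    count (fun d => f d \in X) c + count (fun d => f d \in Y) c.
  rewrite -(count_predUI (fun d => f d \in X)) addnC.
  by congr (_ + _); apply: eq_count => d; rewrite /= inE.
have odd_count (f : I * bool -> V) (X : {set V}) :
    odd (count (fun d => f d \in X) c) = \big[addb/false]_(d <- c) (f d \in X).
  rewrite -sum1_count big_mkcond odd_sum.
  by apply: eq_bigr => d _; case: (f d \in X).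
(* This is the slack left once the cycle is oriented. By [feas] the subtraction is exact on
   nontrivial sets, and [S] and [T] are modular, so submodularity survives. *)
have [|||s Hs] := IHn U' (fun X => b X + S X - T X).
- apply: leq_trans (proper_card _) ltUn; rewrite properEneq subsetDl andbT.
  apply/eqP=> /setP; case: (c) c_neq0 cU @U' {bigU} => [|d c'] //= _ cU.
  by move/(_ d.1); rewrite !inE eqxx cU ?mem_head.
- move=> X Y XY0 XYT; have := b_submod X Y XY0 XYT.
  have [_ _ ntI ntU] := crossing_nontrivial XY0 XYT.
  have := feas _ ntI; have := feas _ ntU.
  by have := count_mod src X Y; have := count_mod dst X Y; rewrite /S /T; lia.
- move=> X ntX; have := feas X ntX => le_T.
  (* Modulo 2, [S X + T X] is the part of the cut contributed by the cycle, which cancels and leaves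
     the cut of [U']. *)
  rewrite oddB // oddD oddb // /cut_parity (bigU _ _ addb) /S /T !odd_count.
  rewrite (eq_bigr _ (fun d _ => separatedE d X)) big_split /=.
  move: (\big[_/_]_(d <- c) (src d \in X)) (\big[_/_]_(d <- c) (dst d \in X)).
  by move: (\big[_/_]_(i in U') _) => [] [] [].
(* On the cycle this is the orientation used there; elsewhere the index is out of range and the
   default yields [s i]. *)
pose s' i := (nth (i, s i) c (index i (map fst c))).2.
have s'c d : d \in c -> (d.1, s' d.1) = d.
  case/(nthP d)=> k ltkc <-; rewrite /s' -(nth_map d d.1) //.
  rewrite index_uniq ?size_map // (set_nth_default d) // [RHS]surjective_pairing.
  by rewrite (nth_map d).
have s'U' j : j \in U' -> s' j = s j.
  rewrite !inE => /andP[jc _]; rewrite /s' nth_default //.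
  by rewrite -(size_map fst) leqNgt index_mem.
exists s' => X ntX; rewrite !(bigU _ _ addn) /=.
have cE f : \sum_(d <- c) (f (d.1, s' d.1) \in X : nat) = count (fun d => f d \in X) c.
  rewrite -sum1_count [RHS]big_mkcond /= big_seq [RHS]big_seq.
  by apply: eq_bigr => d dc; rewrite s'c //; case: (_ \in X).
have U'E f : \sum_(j in U') (f (j, s' j) \in X : nat) = \sum_(j in U') (f (j, s j) \in X).
  by apply: eq_bigr => j jU'; rewrite s'U'.
rewrite (cE dst) (cE src) (U'E dst) (U'E src).
by have := Hs X ntX; have := feas X ntX; rewrite -/(S X) -/(T X); lia.
Qed.

End Rounding.

(** * Cuts of the doubled graph *)

Definition crosses (V : finType) (A X : {set V}) := #|A :&: X| == 1.

Lemma crosses_set2 (V : finType) (x y : V) X : x != y ->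
  crosses [set x; y] X = (x \in X) (+) (y \in X).
Proof.
move=> xy; suff ->: crosses [set x; y] X = ((x \in X) + (y \in X) == 1).
  by case: (x \in X); case: (y \in X).
rewrite /crosses -sum1_card (eq_bigl (fun z => (z \in [set x; y]) && (z \in X))).
  by rewrite big_mkcondr big_setU1 ?inE //= big_set1; do 2!case: ifP.
by move=> z; rewrite inE.
Qed.

Lemma crossesC (V : finType) (A X : {set V}) : #|A| = 2 ->
  crosses A (~: X) = crosses A X.
Proof.
by move=> A2; rewrite /crosses; have := cardsID X A; rewrite setDE A2; lia.
Qed.

Lemma card_set_sum (T : finType) (P : pred T) : #|[set x | P x]| = \sum_x P x.
Proof. by rewrite -sum1dep_card big_mkcond; apply: eq_bigr => x _; case: (P x). Qed.

Lemma card_double_cut (V : finType) (G : graph V) (D : {set edge G}) X :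
  #|edge_cut (double_graph D) X| =
  \sum_(e : edge G) crosses (ends e) X + \sum_(e in D) crosses (ends e) X.
Proof. by rewrite card_set_sum big_sumType [X in _ = _ + X]big_sub. Qed.

(** * From a doubling to a partial orientation *)

Lemma orient_doubled (V : finType) (G : graph V) (D : {set edge G}) :
    edge_connected 4 (double_graph D) ->
  exists M : mixed_graph V,
    [/\ partial_orientation G M, arc_strong 2 M & #|medge M| = #|D|].
Proof.
move=> conn.
have [pq pqE] : exists pq : edge G -> V * V,
    forall e, (pq e).1 != (pq e).2 /\ ends e = [set (pq e).1; (pq e).2].
  apply: (@fin_all_exists (edge G) (fun=> (V * V)%type)
    (fun e xy => xy.1 != xy.2 /\ ends e = [set xy.1; xy.2])) => e.
  by have /eqP/cards2P[x [y xy]] := card_ends G e; exists (x, y).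
pose p e := (pq e).1; pose q e := (pq e).2.
have pq_neq e : p e != q e by have [] := pqE e.
have endsE e : ends e = [set p e; q e] by have [] := pqE e.
have crossE (e : edge G) X : crosses (ends e) X = separated p q e X.
  by rewrite endsE crosses_set2.
(* The degree of [X] in the doubled graph, that is, twice its out-weight in the half-integral
   orientation. *)
pose w X := \sum_(e : edge G) crosses (ends e) X + \sum_(e in D) crosses (ends e) X.
have w_ge4 X : nontrivial X -> 4 <= w X.
  by case/andP=> X0 XT; rewrite /w -card_double_cut conn // properT.
have wE X : w X =
    \sum_(e in ~: D) separated p q e X + (\sum_(e in D) separated p q e X).*2.
  rewrite /w (bigID [in D]) /= addnC addnA addnn -[RHS]addnC.
  congr (_.*2 + _); first by apply: eq_bigr => e _; rewrite crossE.
  by apply: eq_big => [e|e _]; rewrite ?inE ?crossE.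
have w_submod X Y : w (X :&: Y) + w (X :|: Y) <= w X + w Y.
  have cross_submod (e : edge G) :
      crosses (ends e) (X :&: Y) + crosses (ends e) (X :|: Y) <=
      crosses (ends e) X + crosses (ends e) Y.
    rewrite !crossE /separated !inE.
    by case: (p e \in X); case: (p e \in Y); case: (q e \in X); case: (q e \in Y).
  rewrite /w addnACA -!big_split /= [X in _ <= X]addnACA -!big_split.
  by apply: leq_add; apply: leq_sum => e _; apply: cross_submod.
have [||s Hs] := @half_integral_rounding V (edge G) p q (~: D) (fun X => w X - 4).
- move=> X Y /crossing_nontrivial/[apply]-[/w_ge4 wX /w_ge4 wY].
  by move=> /w_ge4 wI /w_ge4 wU; have := w_submod X Y; lia.
(* Edges of [D] count twice and 4 is even, so only the edges outside [D] affect the parity. *)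
- move=> X /w_ge4 w4; rewrite oddB // addbF wE oddD odd_double addbF odd_sum.
  by apply: eq_bigr => e _; rewrite oddb.
pose u e := src p q (e, s e); pose v e := dst p q (e, s e).
have uv e : u e != v e.
  by rewrite /u /v /src /dst /=; case: (s e) => //; rewrite eq_sym.
have endsuv e : ends e = [set u e; v e].
  by rewrite /u /v /src /dst /= endsE; case: (s e) => //; rewrite setUC.
pose M := @MixedGraph V {e | e \in D} (fun e => ends (val e))
  (fun e => card_ends G (val e)) {e | e \in ~: D} (fun e => u (val e))
  (fun e => v (val e)) (fun e => uv (val e)).
exists M; split.
- exists (fun x => match x with inl e => val e | inr a => val a end); split=> //.
  apply: inj_card_bij => [[x|x] [y|y] /= xy|].
  + by congr inl; apply: val_inj.
  + by have := valP y; rewrite inE /= -xy (valP x).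
  + by have := valP x; rewrite inE /= xy (valP y).
  + by congr inr; apply: val_inj.
  rewrite card_sum !card_sig -(cardsC D).
  by apply: eq_leq; congr (_ + _); apply: eq_card => x; rewrite !inE.
- move=> X X0; rewrite properT => XT.
  have ntX : nontrivial X by rewrite /nontrivial X0.
  have := w_ge4 X ntX; rewrite wE.
  have -> : #|medge_cut M X| = \sum_(e in D) separated p q e X.
    by rewrite card_set_sum [RHS]big_sub; apply: eq_bigr => e _; rewrite -crossE.
  have -> : #|arcs_leaving M X| = \sum_(e in ~: D) ((u e \in X) && (v e \notin X)).
    by rewrite card_set_sum [RHS]big_sub.
  (* Edge by edge: adding the tail indicator and subtracting the head indicator makes a leaving arc
     count 2 and an entering arc 0. With [Hs], twice the quantity to bound is at least 4. *)
  have : \sum_(e in ~: D) separated p q e X + \sum_(e in ~: D) (u e \in X) =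
      (\sum_(e in ~: D) ((u e \in X) && (v e \notin X))).*2 +
      \sum_(e in ~: D) (v e \in X).
    rewrite -addnn -!big_split; apply: eq_bigr => e _ /=.
    rewrite -crossE endsuv crosses_set2 //.
    by case: (u e \in X); case: (v e \in X).
  by have := Hs X ntX; rewrite wE /u /v; lia.
by rewrite card_sig.
Qed.

(** * From a partial orientation to a doubling *)

Lemma double_unoriented (V : finType) (G : graph V) (M : mixed_graph V) :
    partial_orientation G M -> arc_strong 2 M ->
  exists D : {set edge G}, #|D| = #|medge M| /\ edge_connected 4 (double_graph D).
Proof.
move=> [f [f_bij f_edge f_arc]] strong.
have f_inj : injective (f \o inl).
  by move=> x y /(bij_inj f_bij)[].
exists [set f (inl e) | e in [set: medge M]]; split.
  by rewrite card_imset ?cardsT.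
move=> X X0 XT; rewrite card_double_cut.
rewrite big_imset /=; last by move=> x y _ _ /f_inj.
rewrite (reindex f) /=; last exact: onW_bij.
rewrite big_sumType /=.
have cutE (Y : {set V}) : #|medge_cut M Y| = \sum_(e : medge M) crosses (mends e) Y.
  by rewrite card_set_sum.
have -> : \sum_(e in [set: medge M]) crosses (ends (f (inl e))) X = #|medge_cut M X|.
  by rewrite cutE; apply: eq_big => [e|e _]; rewrite ?inE ?f_edge.
have -> : \sum_(e : medge M) crosses (ends (f (inl e))) X = #|medge_cut M X|.
  by rewrite cutE; apply: eq_bigr => e _; rewrite f_edge.
(* A crossing arc leaves exactly one of [X] and its complement. *)
have -> : \sum_(a : Defs.arc M) crosses (ends (f (inr a))) X =
    #|arcs_leaving M X| + #|arcs_leaving M (~: X)|.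
  rewrite !card_set_sum -big_split; apply: eq_bigr => a _ /=.
  rewrite f_arc crosses_set2 ?tail_neq_head // !inE.
  by case: (tail a \in X); case: (Defs.head a \in X).
have /strong : ~: X != set0.
  by apply: contraTneq XT => XC0; rewrite -[X]setCK XC0 setC0 properT eqxx.
rewrite properT; have -> : ~: X != setT.
  by apply: contraNneq X0 => XCT; rewrite -[X]setCK XCT setCT.
move=> /(_ isT); have := strong X X0 XT.
have -> : #|medge_cut M (~: X)| = #|medge_cut M X|.
  by rewrite !cutE; apply: eq_bigr => e _; rewrite crossesC ?card_mends.
lia.
Qed.

Theorem lemma3p6 (V : finType) (G : graph V) (k : nat) :
  edge_connected 2 G -> 0 < k ->
  (exists D : {set edge G}, #|D| <= k /\ edge_connected 4 (double_graph D))
  <->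
  (exists M : mixed_graph V,
     [/\ partial_orientation G M, arc_strong 2 M & #|medge M| <= k]).
Proof.
move=> _ _; split=> [[D [leDk /orient_doubled[M [GM strong DM]]]]|].
  by exists M; rewrite DM.
move=> [M [GM strong leMk]]; have [D [DM conn]] := double_unoriented GM strong.
by exists D; rewrite DM.
Qed.
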